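(* Assume that $\gamma<1$ and $\delta<1$. Then, for all $v\in V$, $$\lim_{n\to\infty}\frac{Y_n(v)}{n}=\frac{1}{2m}\quad\text{a.s.}$$ In particular, $$\lim_{n\to\infty}\frac{S_n}{n}=0\in\mathbf{R}^d\quad\text{a.s.}$$
   Context: Setting. Let $d\ge 1$ and let $\mathcal{S}_{\mathfrak{e}},\mathcal{S}_{\mathfrak{o}},V_{\mathfrak{e}},V_{\mathfrak{o}}\subset\mathbf{R}^d$, with $V_{\mathfrak{o}},V_{\mathfrak{e}}$ finite, satisfy: (1) $x+v\in\mathcal{S}_{\mathfrak{o}}$ for $x\in\mathcal{S}_{\mathfrak{e}}$, $v\in V_{\mathfrak{o}}$; (2) $x+v\in\mathcal{S}_{\mathfrak{e}}$ for $x\in\mathcal{S}_{\mathfrak{o}}$, $v\in V_{\mathfrak{e}}$; (3) $V_{\mathfrak{o}}=-V_{\mathfrak{e}}$; (4) $0\in\mathcal{S}_{\mathfrak{e}}$; (5) $V_{\mathfrak{o}}\cap V_{\mathfrak{e}}=\emptyset$. Put $V=V_{\mathfrak{o}}\cup V_{\mathfrak{e}}$, let $m$ be the common cardinality of $V_{\mathfrak{o}}$ and $V_{\mathfrak{e}}$, and assume $m\ge2$. Fix $p,q\in[0,1]$ and set $\alpha=\frac{mp-1}{m-1}$, $\beta=\frac{mq-1}{m-1}$, $\gamma=\frac12(\alpha+\beta)$, $\delta=\frac12(\alpha-\beta)$. For each $k\ge2$ and $v\in V$ let $G_k(v)$ be a random variable with values in $V_{\mathfrak{o}}$ if $k$ is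 odd and in $V_{\mathfrak{e}}$ if $k$ is even, with the following law. Let $W$ denote $V_{\mathfrak{o}}$ if $k$ is odd and $V_{\mathfrak{e}}$ if $k$ is even, and let $w\in W$. If $v\in W$, then $\boldsymbol{P}(G_k(v)=w)=p$ for $w=v$ and $\frac{1-p}{m-1}$ for $w\ne v$. If $v\in V\setminus W$ (so $-v\in W$), then $\boldsymbol{P}(G_k(v)=w)=q$ for $w=-v$ and $\frac{1-q}{m-1}$ for $w\neq -v$. Let $X_1$ be uniform on $V_{\mathfrak{o}}$ and, for $n\ge1$, let $\mathcal{U}_n$ be uniform on $\{1,\dots,n\}$. The $\sigma$-fields $\sigma(X_1),\ \sigma(\mathcal{U}_1,\{G_2(v)\}_{v\in V}),\ \sigma(\mathcal{U}_2,\{G_3(v)\}_{v\in V}),\dots$ are independent, and for each $n\ge1$, $\mathcal{U}_n$ is independent of $\{G_{n+1}(v)\}_{v\in V}$. Define, for $n\geq 1$, $X_{n+1}=G_{n+1}(X_{\mathcal{U}_n})$; and $S_0=0$, $S_{n+1}=S_n+X_{n+1}$ for $n\ge0$ (the elephant random walk). For $v\in V$, $Y_n(v)$ is the number of $k\in\{1,\dots,n\}$ with $X_k=v$. *)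

(* Defs.v *)
From HB Require Import structures.
From mathcomp Require Import all_boot all_order all_algebra finmap.
From mathcomp Require Import all_classical all_reals all_analysis.

Set Implicit Arguments.
Unset Strict Implicit.
Unset Printing Implicit Defensive.

Import Order.TTheory GRing.Theory Num.Theory.
Import numFieldNormedType.Exports.

Local Open Scope classical_set_scope.
Local Open Scope ring_scope.

(* The library puts no measurableType structure on 'rV[R]_d. *)
Definition borel_rV (R : realType) (d : nat) :=
  g_sigma_algebraType (@open 'rV[R]_d).

Definition mutually_independent {disp} {Omega : measurableType disp}
    {R : realType} (P : probability Omega R) (I : choiceType)
    (F : I -> set (set Omega)) : Prop :=
  forall (J : {fset I}) (A : I -> set Omega),
    (forall j, j \in J -> F j (A j)) ->
    P (\bigcap_(j in [set` J]) A j) = (\prod_(j <- J) P (A j))%E.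

Definition independent2 {disp} {Omega : measurableType disp}
    {R : realType} (P : probability Omega R) (F1 F2 : set (set Omega)) : Prop :=
  forall A B, F1 A -> F2 B -> P (A `&` B) = (P A * P B)%E.

Record step_geometry (R : realType) (d : nat) (Se So : set 'rV[R]_d)
    (Ve Vo : {fset 'rV[R]_d}) (m : nat) : Prop := StepGeometry {
  geo_even_odd : forall x v, Se x -> v \in Vo -> So (x + v);
  geo_odd_even : forall x v, So x -> v \in Ve -> Se (x + v);
  geo_opp : Vo = [fset - v | v in Ve]%fset;
  geo_origin : Se 0;
  geo_disjoint : (Vo `&` Ve = fset0)%fset;
  geo_card_odd : #|` Vo| = m;
  geo_card_even : #|` Ve| = m
}.

Section parameters.
Context {R : realType} (m : nat) (p q : R).

Definition alpha : R := (m%:R * p - 1) / (m%:R - 1).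
Definition beta : R := (m%:R * q - 1) / (m%:R - 1).
Definition gamma : R := 2^-1 * (alpha + beta).
Definition delta : R := 2^-1 * (alpha - beta).

End parameters.

Section walk.
Context {disp} {Omega : measurableType disp} {R : realType} {d : nat}.
Implicit Types (Ve Vo : {fset 'rV[R]_d}) (X : nat -> Omega -> 'rV[R]_d)
  (U : nat -> Omega -> nat) (G : nat -> 'rV[R]_d -> Omega -> 'rV[R]_d).

Definition sigma_rV (f : Omega -> 'rV[R]_d) : set (set Omega) :=
  preimage_set_system setT f (@measurable _ (borel_rV R d)).

Definition sigma_nat (f : Omega -> nat) : set (set Omega) :=
  preimage_set_system setT f measurable.

Definition sigma_family (V : {fset 'rV[R]_d}) (f : 'rV[R]_d -> Omega -> 'rV[R]_d)
    : set (set Omega) :=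
  <<s \bigcup_(v in [set` V]) sigma_rV (f v) >>.

(* sigma(X_1) for n = 0 and sigma(U_n, {G_{n+1}(v)}_{v in V}) for n >= 1 *)
Definition sigma_step Ve Vo X U G (n : nat) : set (set Omega) :=
  if n is 0%N then sigma_rV (X 1%N)
  else <<s sigma_nat (U n) `|` sigma_family (Vo `|` Ve)%fset (G n.+1) >>.

Definition steps_at Ve Vo (k : nat) : {fset 'rV[R]_d} := if odd k then Vo else Ve.

(* X 0, U 0, G 0 and G 1 are unconstrained junk values, as is G k v for v
   outside V. *)
Record elephant_walk (P : probability Omega R) Ve Vo (m : nat) (p q : R)
    X U G : Prop := ElephantWalk {
  ew_G_measurable : forall k v, (2 <= k)%N -> v \in (Vo `|` Ve)%fset ->
    measurable_fun setT (G k v : Omega -> borel_rV R d);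
  ew_G_values : forall k v omega, (2 <= k)%N -> v \in (Vo `|` Ve)%fset ->
    G k v omega \in steps_at Ve Vo k;
  ew_G_law_same : forall k v w, (2 <= k)%N ->
    v \in steps_at Ve Vo k -> w \in steps_at Ve Vo k ->
    P (G k v @^-1` [set w]) =
      (if w == v then p else (1 - p) / (m%:R - 1))%:E;
  ew_G_law_opp : forall k v w, (2 <= k)%N ->
    v \in ((Vo `|` Ve) `\` steps_at Ve Vo k)%fset -> w \in steps_at Ve Vo k ->
    P (G k v @^-1` [set w]) =
      (if w == - v then q else (1 - q) / (m%:R - 1))%:E;
  ew_X1_measurable : measurable_fun setT (X 1%N : Omega -> borel_rV R d);
  ew_X1_values : forall omega, X 1%N omega \in Vo;
  ew_X1_law : forall v, v \in Vo -> P (X 1%N @^-1` [set v]) = (m%:R^-1)%:E;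
  ew_U_measurable : forall n, (1 <= n)%N -> measurable_fun setT (U n);
  ew_U_values : forall n omega, (1 <= n)%N -> (1 <= U n omega <= n)%N;
  ew_U_law : forall n j, (1 <= n)%N -> (1 <= j <= n)%N ->
    P (U n @^-1` [set j]) = (n%:R^-1)%:E;
  ew_indep : mutually_independent P (sigma_step Ve Vo X U G);
  ew_indep_UG : forall n, (1 <= n)%N ->
    independent2 P (sigma_nat (U n)) (sigma_family (Vo `|` Ve)%fset (G n.+1));
  ew_rec : forall n omega, (1 <= n)%N ->
    X n.+1 omega = G n.+1 (X (U n omega) omega) omega
}.

Fixpoint position X (n : nat) (omega : Omega) : 'rV[R]_d :=
  if n is n'.+1 then position X n' omega + X n'.+1 omega else 0.

Definition count_steps X (n : nat) (v : 'rV[R]_d) (omega : Omega) : nat :=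
  count (fun k => X k omega == v) (iota 1 n).

End walk.

(* Main.v *)
Require Import Defs.
From HB Require Import structures.
From mathcomp Require Import all_boot all_order all_algebra finmap.
From mathcomp Require Import all_classical all_reals all_analysis.
From mathcomp Require Import measurable_realfun.
From mathcomp Require Import zify ring lra.

Set Implicit Arguments.
Unset Strict Implicit.
Unset Printing Implicit Defensive.

Import Order.TTheory GRing.Theory Num.Theory.
Import numFieldNormedType.Exports.

Local Open Scope classical_set_scope.
Local Open Scope ring_scope.

(** Fix an odd step [v], let [a] and [b] count the occurrences of [v] and [- v]
among the first [n] steps, and centre both by [n / 2m].  The next step copies a
uniformly chosen past step up to noise, and the law of the noise is affine in
the indicators of that past step being [v] or [- v].  Given the first [n]
steps, [n] even, the conditional expectation of the increment of [a] over two
steps is therefore [(alpha a + beta b) / n], and that of [b] is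
[(beta a + alpha b) / n], up to O(1/n).  The quadratic potential
[V = a^2 + b^2] thus satisfies, at even times [n = 2k],

  [E V(2k+2) <= (1 + (alpha + |beta|) / k) E V(2k) + 10].

The eigenvalues [alpha + beta] and [alpha - beta] of the coupling matrix are
twice [gamma] and [delta], so the hypotheses say exactly that
[alpha + |beta| < 2].  Since [((k+1)/k)^2] is about [1 + 2/k], the sequence
[E V(2k) / k^2] loses a fixed multiple of [E V(2k) / k^3] at each step, up to
a summable error, and telescoping gives [sum_k E V(2k) / k^3 < oo]
([summable_of_drift], fed by [potential_drift]).

By monotone convergence [sum_k V(2k) / k^3] is finite almost surely.  The rest
is deterministic: [a] moves by at most one at each step, so if [|a| >= e n] at
some large [n], then [|a| >= e n / 2] on a whole block of length proportional
to [n], and that block alone contributes a constant to the sum.  Hence [a / n] tends to [0]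
([ratio_cvg0_of_summable_squares]).  The statement on the position follows,
because the position is the sum of the steps weighted by their counts and the
set of steps is symmetric.

The expectations above are finite sums over paths.  They are tied to the
probability space by [trajectory_law]: the event that the walk follows a given
path is a finite disjoint union of intersections of events belonging to
different independent sigma-fields, so its probability is the product of the
transition probabilities. *)

(** * Sequences with bounded steps and summable squares *)

Lemma unit_steps_dist (R : realType) (z : nat -> R) (n i : nat) :
  (forall k, `|z k.+1 - z k| <= 1) -> `|z (n + i)%N - z n| <= i%:R.
Proof.
move=> hz; elim: i => [|i IH]; first by rewrite addn0 subrr normr0.
rewrite addnS -natr1.
have -> : z (n + i).+1 - z n = (z (n + i)%N - z n) + (z (n + i).+1 - z (n + i)%N).
  by ring.
by rewrite (le_trans (ler_normD _ _))// lerD.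
Qed.

(** If [|z n| >= t (n+1)], unit steps keep [|z| >= t (n+1) / 2] during the next
[t (n+1) / 2] indices, and the terms of the series over that block add up to at
least [t^3 / 64], a constant that the tails of a convergent series eventually
stay below. *)
Lemma ratio_cvg0_of_summable_squares (R : realType) (z : nat -> R) :
  (forall k, `|z k.+1 - z k| <= 1) ->
  (\sum_(0 <= k <oo) (z k ^+ 2 / k.+1%:R ^+ 3)%:E < +oo)%E ->
  z k / k.+1%:R @[k --> \oo] --> (0 : R).
Proof.
move=> hz hs; apply/cvgr0Pnorm_lt => e e0.
(* [t <= 1] keeps the indices of the block below [2 (n+1)]. *)
pose t : R := Num.min e 1.
have t0 : 0 < t by rewrite lt_min e0 ltr01.
have te : t <= e by rewrite ge_min lexx.
have t1 : t <= 1 by rewrite ge_min lexx orbT.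
have f0 k : (0 <= (z k ^+ 2 / k.+1%:R ^+ 3)%:E)%E.
  by rewrite lee_fin divr_ge0 ?sqr_ge0 ?exprn_ge0.
have /fine_cvgP[tail_fin /cvgr0Pnorm_lt/(_ (t ^+ 3 / 64))] :=
  nneseries_tail_cvg hs (fun k _ => f0 k).
rewrite divr_gt0 ?exprn_gt0// => /(_ isT) tail_small.
near=> n.
have tfin : (\sum_(n <= k <oo) (z k ^+ 2 / k.+1%:R ^+ 3)%:E)%E \is a fin_num.
  by near: n.
have : `|fine ((\sum_(n <= k <oo) (z k ^+ 2 / k.+1%:R ^+ 3)%:E)%E)| < t ^+ 3 / 64.
  by near: n.
rewrite !ltNge; apply: contra => hn.
pose s : R := n.+1%:R.
have s0 : 0 < s by rewrite ltr0n.
have zn : t * s <= `|z n|.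
  rewrite -ler_pdivlMr// (le_trans te)// (le_trans hn)// normrM.
  by rewrite normfV (ger0_norm (ltW s0)).
pose r := Num.truncn (t * s / 2).
have /andP[r1 r2] : r%:R <= t * s / 2 < r.+1%:R.
  by apply: truncn_itv; rewrite divr_ge0// ltW// mulr_gt0.
rewrite (le_trans _ (ler_norm _))// -lee_fin fineK//.
apply: le_trans (nneseries_lim_ge (n + r.+1) _); last by move=> *.
rewrite sumEFin lee_fin.
apply: (@le_trans _ _ (\sum_(n <= k < n + r.+1) ((t * s / 2) ^+ 2 / (2 * s) ^+ 3))).
  rewrite sumr_const_nat addKn -[leRHS]mulr_natl.
  have := ltW r2; set a := t * s / 2 => ra.
  apply: (@le_trans _ _ (a * (a ^+ 2 / (2 * s) ^+ 3))).
    rewrite le_eqVlt; apply/orP; left; apply/eqP; rewrite /a; field.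
    by rewrite gt_eqF.
  by rewrite ler_wpM2r// divr_ge0 ?sqr_ge0// exprn_ge0// mulr_ge0// ltW.
apply: ler_sum_nat => k /andP[nk kn].
have ik : (k - n)%:R <= t * s / 2.
  by apply: le_trans r1; rewrite ler_nat leq_subLR -ltnS -addnS.
have hk : t * s / 2 <= `|z k|.
  have := unit_steps_dist n (k - n) hz; rewrite subnKC// => hd.
  have := lerB_dist (z n) (z k); rewrite distrC => hd'.
  lra.
have ts0 : 0 <= t * s / 2 by rewrite divr_ge0// ltW// mulr_gt0.
apply: ler_pM; rewrite ?sqr_ge0 ?invr_ge0 ?exprn_ge0 ?mulr_ge0 ?(ltW s0)//.
  by rewrite -[leRHS]real_normK ?num_real// ler_pXn2r ?nnegrE.
rewrite lef_pV2 ?posrE ?exprn_gt0 ?mulr_gt0//.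
rewrite ler_pXn2r ?nnegrE ?mulr_ge0 ?(ltW s0)//.
have kE : k.+1%:R = s + (k - n)%:R :> R.
  by rewrite /s -natrD addSn subnKC.
have : t * s <= s by rewrite ger_pMl.
by rewrite kE; lra.
Unshelve. all: by end_near.
Qed.

(** The drift estimate is available along even times only.  Halving the
even-time sequence makes its steps at most one again. *)
Lemma ratio_cvg0_of_even_summable (R : realType) (c : nat -> R) :
  (forall n, `|c n.+1 - c n| <= 1) ->
  (\sum_(0 <= k <oo) (c (2 * k.+1)%N ^+ 2 / k.+1%:R ^+ 3)%:E < +oo)%E ->
  c n / n%:R @[n --> \oo] --> (0 : R).
Proof.
move=> hc hs; pose z k := c (2 * k.+1)%N / 2.
have z1 k : `|z k.+1 - z k| <= 1.
  rewrite /z -mulrBl normrM normfV (ger0_norm (ler0n _ 2)) ler_pdivrMr// mul1r.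
  have -> : (2 * k.+2 = 2 * k.+1 + 2)%N by lia.
  exact: unit_steps_dist.
have zs : (\sum_(0 <= k <oo) (z k ^+ 2 / k.+1%:R ^+ 3)%:E < +oo)%E.
  apply: le_lt_trans hs; apply: lee_nneseries => k _.
    by rewrite lee_fin divr_ge0 ?sqr_ge0 ?exprn_ge0.
  rewrite lee_fin ler_pM2r ?invr_gt0 ?exprn_gt0// /z expr_div_n ler_pdivrMr ?exprn_gt0//.
  by rewrite ler_peMr ?sqr_ge0// -natrX ler1n.
have /cvgr0Pnorm_lt hz := ratio_cvg0_of_summable_squares z1 zs.
apply/cvgr0Pnorm_lt => e e0.
have e2 : 0 < e / 2 by rewrite divr_gt0.
have [N _ hN] := hz _ e2.
near=> n.
have n2 : (2 * N.+1 <= n)%N by near: n; exact: nbhs_infty_ge.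
have n1 : 2 / e < n%:R by near: n; exact: nbhs_infty_gtr.
have n0 : 0 < n%:R :> R by rewrite ltr0n; lia.
(* [2 (k+1)] is the largest even index up to [n]. *)
pose k := (n./2).-1.
have kN : (N <= k)%N by rewrite /k; lia.
have kn : (2 * k.+1 <= n)%N by rewrite /k; lia.
have kn' : (n - 2 * k.+1 <= 1)%N by rewrite /k; lia.
have := hN k kN; rewrite /= normrM normfV (gtr0_norm (_ : 0 < k.+1%:R))// => hzk.
have := unit_steps_dist (2 * k.+1) (n - 2 * k.+1) hc; rewrite subnKC// => hd.
have hd1 : `|c n| <= 1 + 2 * `|z k|.
  have -> : 2 * `|z k| = `|c (2 * k.+1)%N|.
    by rewrite /z normrM normfV (ger0_norm (ler0n _ 2)); field.
  rewrite -lerBlDr (le_trans (lerB_dist _ _))// (le_trans hd)//.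
  by rewrite -[1]/(1%:R) ler_nat.
rewrite normrM normfV (gtr0_norm n0) ltr_pdivrMr// (le_lt_trans hd1)//.
move: hzk; rewrite ltr_pdivrMr// => hzk.
have : 2 < e * n%:R by move: n1; rewrite ltr_pdivrMr// mulrC.
have : 2 * k.+1%:R <= n%:R :> R by rewrite -natrM ler_nat.
rewrite -(ler_pM2l e0).
lra.
Unshelve. all: by end_near.
Qed.

Lemma sum_indicator_count (R : pzSemiRingType) (T : Type) (a : pred T) (s : seq T) :
  \sum_(u <- s) (a u)%:R = (count a s)%:R :> R.
Proof.
elim: s => [|u s IH]; first by rewrite big_nil.
by rewrite big_cons /= IH natrD.
Qed.

(** * Paths and their probabilities *)

Section geometry.
Context {R : realType} {d : nat} {Se So : set 'rV[R]_d}
  {Ve Vo : {fset 'rV[R]_d}} {m : nat} (hgeo : step_geometry Se So Ve Vo m).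

Lemma mem_opp_odd v : (- v \in Vo) = (v \in Ve).
Proof.
rewrite (geo_opp hgeo); apply/imfsetP/idP => [[u /= hu]|hv]; last by exists v.
by move/oppr_inj ->.
Qed.

Lemma mem_opp_even v : (- v \in Ve) = (v \in Vo).
Proof. by rewrite -mem_opp_odd opprK. Qed.

Lemma mem_even v : v \in (Vo `|` Ve)%fset -> (v \in Ve) = (v \notin Vo).
Proof.
rewrite inE; case: (boolP (v \in Vo)) => //= hvo _; apply/negbTE/negP => hve.
have : v \in (Vo `&` Ve)%fset by rewrite inE hvo hve.
by rewrite (geo_disjoint hgeo).
Qed.

Lemma steps_at_sub k : {subset steps_at Ve Vo k <= (Vo `|` Ve)%fset}.
Proof.
by rewrite /steps_at => v; case: odd => hv; rewrite inE hv ?orbT.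
Qed.

Lemma mem_steps_at k v : v \in (Vo `|` Ve)%fset ->
  (v \in steps_at Ve Vo k) = ((v \in Vo) == odd k).
Proof.
by move=> hv; rewrite /steps_at; case: odd; rewrite ?mem_even//; case: (v \in Vo).
Qed.

Lemma mem_opp_steps_at k v : v \in (Vo `|` Ve)%fset ->
  (- v \in steps_at Ve Vo k) = (v \notin steps_at Ve Vo k).
Proof.
move=> hv; rewrite mem_steps_at//; rewrite /steps_at; case: odd.
  by rewrite mem_opp_odd mem_even; case: (v \in Vo).
by rewrite mem_opp_even; case: (v \in Vo).
Qed.

Lemma card_steps_at k : size (steps_at Ve Vo k) = m.
Proof.
by rewrite /steps_at; case: odd; [exact: geo_card_odd hgeo|exact: geo_card_even hgeo].
Qed.

End geometry.

Section path_law.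
Context {R : realType} {d : nat}.
Variables (Ve Vo : {fset 'rV[R]_d}) (m : nat) (p q : R).

(** The probability that a remembered step [u] produces the step [w]; the parity
of the time enters only through the class of [w], hence the comparison of
classes instead of a time index. *)
Definition step_kernel (u w : 'rV[R]_d) : R :=
  if (u \in Vo) == (w \in Vo) then (if w == u then p else (1 - p) / (m%:R - 1))
  else (if w == - u then q else (1 - q) / (m%:R - 1)).

(** Paths are listed from the latest step to the first one. *)
Definition next_prob (x : seq 'rV[R]_d) (w : 'rV[R]_d) : R :=
  if x is [::] then m%:R^-1 else (size x)%:R^-1 * \sum_(u <- x) step_kernel u w.

Fixpoint path_prob (x : seq 'rV[R]_d) : R :=
  if x is w :: y then path_prob y * next_prob y w else 1.

Fixpoint paths (n : nat) : seq (seq 'rV[R]_d) :=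
  if n is n'.+1 then [seq w :: x | x <- paths n', w <- steps_at Ve Vo n]
  else [:: [::]].

Definition path_mean (n : nat) (f : seq 'rV[R]_d -> R) : R :=
  \sum_(x <- paths n) path_prob x * f x.

Lemma mem_paths0 x : (x \in paths 0) = (x == [::]).
Proof. by rewrite inE. Qed.

Lemma mem_pathsS n w x :
  (w :: x \in paths n.+1) = (w \in steps_at Ve Vo n.+1) && (x \in paths n).
Proof.
apply/allpairsP/andP => [[[y u] /= [hy hu [-> ->]]]//|[hw hx]].
by exists (x, w); split.
Qed.

Lemma uniq_paths n : uniq (paths n).
Proof.
elim: n => //= n IH; apply: allpairs_uniq => //; first exact: fset_uniq.
by move=> [x w] [y u] _ _ /= [-> ->].
Qed.

Lemma size_path n x : x \in paths n -> size x = n.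
Proof.
elim: n x => [|n IH] [|w x]//; first by case/allpairsP => [[]] /= ? ? [].
by rewrite mem_pathsS => /andP[_ /IH/= ->].
Qed.

Lemma path_subset n x : x \in paths n -> {subset x <= (Vo `|` Ve)%fset}.
Proof.
elim: n x => [|n IH] [|w x]//; rewrite mem_pathsS => /andP[hw /IH hx] v.
rewrite inE => /predU1P[->|/hx//]; exact: steps_at_sub hw.
Qed.

Lemma path_meanS n f : path_mean n.+1 f =
  path_mean n (fun x => \sum_(w <- steps_at Ve Vo n.+1) next_prob x w * f (w :: x)).
Proof.
rewrite /path_mean /= big_allpairs_dep/=; apply: eq_bigr => x _.
by rewrite mulr_sumr; apply: eq_bigr => w _; rewrite mulrA.
Qed.

Hypothesis hm : (2 <= m)%N.

Let m1_gt0 : 0 < m%:R - 1 :> R.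
Proof. by rewrite subr_gt0 ltr1n. Qed.

Context {Se So : set 'rV[R]_d} (hgeo : step_geometry Se So Ve Vo m).

(** Indicator form of the kernel.  Summed over the past, the first two indicators
give the counts of [w] and [- w], with the coefficients [alpha] and [beta]; the
last two give the numbers of past steps of each parity, which are
deterministic. *)
Lemma step_kernelE u w : u \in (Vo `|` Ve)%fset -> w \in (Vo `|` Ve)%fset ->
  step_kernel u w = alpha m p * (u == w)%:R + beta m q * (u == - w)%:R
    + (1 - p) / (m%:R - 1) * ((u \in Vo) == (w \in Vo))%:R
    + (1 - q) / (m%:R - 1) * ((u \in Vo) != (w \in Vo))%:R.
Proof.
move=> hu hw; rewrite /step_kernel /alpha /beta.
have m1 : m%:R - 1 != 0 :> R by rewrite gt_eqF.
have oppw : (- w \in Vo) = (w \notin Vo).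
  by rewrite (mem_opp_odd hgeo) (mem_even hgeo hw).
have [e|ne] := eqVneq (u \in Vo) (w \in Vo).
  have -> : (u == - w) = false.
    by apply/eqP => uw; move: e; rewrite uw oppw; case: (w \in Vo).
  by rewrite [w == u]eq_sym; case: (u == w); rewrite /= ?mulr1n ?mulr0n; field.
have -> : (u == w) = false by apply/eqP => uw; move: ne; rewrite uw eqxx.
by rewrite -eqr_oppLR eq_sym; case: (u == - w); rewrite /= ?mulr1n ?mulr0n; field.
Qed.

Lemma step_kernel_sum1 k u : u \in (Vo `|` Ve)%fset ->
  \sum_(w <- steps_at Ve Vo k) step_kernel u w = 1.
Proof.
move=> hu.
have m1 : m%:R - 1 != 0 :> R by rewrite gt_eqF.
transitivity (\sum_(w <- steps_at Ve Vo k) (alpha m p * (pred1 u w)%:R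
    + beta m q * (pred1 (- u) w)%:R
    + ((1 - p) / (m%:R - 1) * ((u \in Vo) == odd k)%:R
    + (1 - q) / (m%:R - 1) * ((u \in Vo) != odd k)%:R))).
  apply: eq_big_seq => w hw.
  have := steps_at_sub hw => hwV.
  have uw : (- u == w) = (u == - w) := eqr_oppLR u w.
  rewrite step_kernelE// addrA /= [w == u]eq_sym [w == - u]eq_sym uw.
  by move: hw; rewrite (mem_steps_at hgeo k hwV) => /eqP ->.
rewrite !big_split/= -!mulr_sumr.
rewrite (sum_indicator_count _ (pred1 u)) (sum_indicator_count _ (pred1 (- u))).
rewrite !count_uniq_mem ?fset_uniq// (mem_opp_steps_at hgeo)// (mem_steps_at hgeo)//.
rewrite !big_const_seq !count_predT (card_steps_at hgeo) !iter_addr_0.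
have mulm (b : bool) : b%:R *+ m = b%:R * m%:R :> R by rewrite mulr_natr.
rewrite /alpha /beta !mulm.
by case: eqP => _ /=; field.
Qed.

Lemma next_prob_sum1 n x k : x \in paths n.+1 ->
  \sum_(w <- steps_at Ve Vo k) next_prob x w = 1.
Proof.
move=> hx; have := size_path hx; have := path_subset hx.
case: x hx => // u x _; rewrite /next_prob; move: (u :: x) => y yV sy.
rewrite -mulr_sumr exchange_big/=.
under eq_big_seq => v hv do rewrite (step_kernel_sum1 k (yV v hv)).
by rewrite big_const_seq count_predT iter_addr_0 sy mulVf// pnatr_eq0.
Qed.

Lemma count_odd_path n x : x \in paths n -> count (mem Vo) x = uphalf n.
Proof.
elim: n x => [|n IH] [|w x]//; first by case/allpairsP => [[]] /= ? ? [].
rewrite mem_pathsS => /andP[hw hx].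
have -> : count (mem Vo) (w :: x) = ((w \in Vo) + count (mem Vo) x)%N by [].
move: (hw); rewrite (IH _ hx) (mem_steps_at hgeo) ?(steps_at_sub hw)// => /eqP ->.
by rewrite /=; lia.
Qed.

Lemma next_probE n x w : x \in paths n.+1 -> w \in steps_at Ve Vo n.+2 ->
  next_prob x w = n.+1%:R^-1 * (alpha m p * (count_mem w x)%:R
    + beta m q * (count_mem (- w) x)%:R
    + (1 - p) / (m%:R - 1) * (n.+1)./2%:R
    + (1 - q) / (m%:R - 1) * (uphalf n.+1)%:R).
Proof.
move=> hx hw; have wV := steps_at_sub hw.
have sx := size_path hx; have xV := path_subset hx.
have co := count_odd_path hx.
have -> : next_prob x w = (size x)%:R^-1 * \sum_(u <- x) step_kernel u w.
  by rewrite /next_prob; case: x sx {hx xV co}.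
rewrite sx; congr (_ * _).
rewrite (eq_big_seq _ (fun u hu => step_kernelE (xV u hu) wV)).
rewrite !big_split/= -!mulr_sumr.
rewrite (sum_indicator_count _ (pred1 w)) (sum_indicator_count _ (pred1 (- w))).
rewrite (sum_indicator_count _ (fun u => (u \in Vo) == (w \in Vo))).
rewrite (sum_indicator_count _ (fun u => (u \in Vo) != (w \in Vo))).
have wo : (w \in Vo) = odd n.
  by move: hw; rewrite (mem_steps_at hgeo)// => /eqP ->; rewrite /= negbK.
have cE : count (fun u => (u \in Vo) == (w \in Vo)) x = (n.+1)./2.
  rewrite wo; case: (boolP (odd n)) => no.
    rewrite (@eq_count _ _ (mem Vo)) => [|u /=]; last by rewrite eqb_id.
    by rewrite co uphalf_half /= no.
  rewrite (@eq_count _ _ (predC (mem Vo))) => [|u /=]; last by case: (u \in Vo).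
  apply/eqP; rewrite -(eqn_add2l (count (mem Vo) x)) count_predC sx co; apply/eqP.
  by rewrite uphalf_half -addnA addnn odd_double_half.
rewrite cE; suff -> : count (fun u => (u \in Vo) != (w \in Vo)) x = uphalf n.+1 by [].
apply/eqP; rewrite -(eqn_add2l (n.+1)./2) -{1}cE.
rewrite (count_predC (fun u => (u \in Vo) == (w \in Vo)) x) sx uphalf_half.
by have := odd_double_half n.+1; rewrite -addnn addnCA => ->.
Qed.

Hypotheses (hp : 0 <= p <= 1) (hq : 0 <= q <= 1).

Lemma step_kernel_ge0 u w : 0 <= step_kernel u w.
Proof.
move: hp hq => /andP[p0 p1] /andP[q0 q1].
rewrite /step_kernel.
case: (_ == _); case: (_ == _) => //; rewrite divr_ge0 ?subr_ge0// ltW//.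
all: by rewrite -subr_gt0.
Qed.

Lemma next_prob_ge0 x w : 0 <= next_prob x w.
Proof.
rewrite /next_prob; case: x => [|u x]; first by rewrite invr_ge0.
by rewrite mulr_ge0 ?invr_ge0// sumr_ge0// => *; exact: step_kernel_ge0.
Qed.

Lemma path_prob_ge0 x : 0 <= path_prob x.
Proof. by elim: x => //= w x IH; rewrite mulr_ge0// next_prob_ge0. Qed.

Lemma path_mean_le n f g : (forall x, x \in paths n -> f x <= g x) ->
  path_mean n f <= path_mean n g.
Proof.
move=> fg; rewrite /path_mean big_seq [leRHS]big_seq ler_sum// => x hx.
by rewrite ler_wpM2l ?path_prob_ge0 ?fg.
Qed.

End path_law.

(** * The quadratic potential and its drift *)

Lemma ler_of_eq_sub (R : numDomainType) (x y x' y' : R) :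
  y' - x' = y - x -> x <= y -> x' <= y'.
Proof. by move=> e h; rewrite -subr_ge0 e subr_ge0. Qed.

(** Conditional law of an odd step: [al + c M = be + c' M = 1] makes the constant
terms add up to exactly [1 / M] when the past contains equally many ([k])
steps of each parity. *)
Lemma centered_rate (R : realFieldType) (al be c c' M k a b : R) :
  0 < k -> 0 < M -> al + c * M = 1 -> be + c' * M = 1 ->
  (2 * k)^-1 * (al * a + be * b + c * k + c' * k) - M^-1 =
  (al * (a - k / M) + be * (b - k / M)) / (2 * k).
Proof.
move=> k0 M0 h1 h2.
have -> : c = (1 - al) / M by rewrite -h1; field; rewrite gt_eqF.
have -> : c' = (1 - be) / M by rewrite -h2; field; rewrite gt_eqF.
by field; rewrite !gt_eqF.
Qed.

(** Same computation one step later, when the past has [2 k + 1] steps and the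
count of the opposite step has grown by [i].  The rate differs from the one at
time [2 k] by O(1/k); multiplied by a centred count, which is O(k), this costs
a constant. *)
Lemma centered_rate_next (R : realFieldType) (al be c c' M k a b i : R) :
  0 < k -> 1 <= M -> al + c * M = 1 -> be + c' * M = 1 ->
  `|al| <= 1 -> `|be| <= 1 -> 0 <= c' <= 1 -> 0 <= i <= 1 ->
  `|a - k / M| <= 2 * k -> `|b - k / M| <= 2 * k ->
  2 * (b - k / M) * ((2 * k + 1)^-1 *
     (al * b + be * (a + i) + c * k + c' * (k + 1)) - M^-1) <=
  (b - k / M) * (al * (b - k / M) + be * (a - k / M)) / k + 8.
Proof.
move=> k0 M1 h1 h2 hal hbe /andP[c0 c1] /andP[i0 i1] ha hb.
have M0 : 0 < M by rewrite (lt_le_trans _ M1).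
have k1 : 0 < 2 * k + 1 by lra.
have -> : c = (1 - al) / M by rewrite -h1; field; rewrite gt_eqF.
have c'E : c' = (1 - be) / M by rewrite -h2; field; rewrite gt_eqF.
set A := a - k / M; set B := b - k / M; set r := be * i + c' - M^-1.
have -> : (2 * k + 1)^-1 * (al * b + be * (a + i) + (1 - al) / M * k + c' * (k + 1))
    - M^-1 = (al * B + be * A + r) / (2 * k + 1).
  by rewrite /A /B /r c'E; field; rewrite !gt_eqF.
set S := al * B + be * A.
have -> : 2 * B * ((S + r) / (2 * k + 1)) =
    B * S / k + 2 * (B * r - B * (S / (2 * k))) / (2 * k + 1).
  by field; rewrite !gt_eqF.
rewrite lerD2l ler_pdivrMr//.
have V0 : 0 < M^-1 by rewrite invr_gt0.
have V1 : M^-1 <= 1 by rewrite invf_le1.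
have hr : `|r| <= 2.
  have : `|be * i| <= 1.
    by rewrite normrM (ger0_norm i0) -[1]mulr1 ler_pM.
  by rewrite !ler_norml /r => /andP[u v]; apply/andP; split; lra.
have hS : `|S / (2 * k)| <= 2.
  rewrite normrM normfV (@gtr0_norm _ (2 * k)) ?mulr_gt0// ler_pdivrMr ?mulr_gt0//.
  apply: (le_trans (ler_normD _ _)); rewrite !normrM.
  have h3 : `|al| * `|B| <= 1 * (2 * k) by rewrite ler_pM.
  have h4 : `|be| * `|A| <= 1 * (2 * k) by rewrite ler_pM.
  lra.
have h5 : `|B * r| <= (2 * k) * 2 by rewrite normrM ler_pM.
have h6 : `|B * (S / (2 * k))| <= (2 * k) * 2 by rewrite normrM ler_pM.
have := ler_norm (B * r); have := ler_norm (- (B * (S / (2 * k)))).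
rewrite normrN; lra.
Qed.

Lemma quadratic_form_le (R : realFieldType) (al be a b : R) :
  al * (a ^+ 2 + b ^+ 2) + 2 * (be * a * b) <= (al + `|be|) * (a ^+ 2 + b ^+ 2).
Proof.
rewrite [leRHS]mulrDl lerD2l (le_trans (ler_norm _))// !normrM (ger0_norm (ler0n _ 2)).
rewrite -(real_normK (num_real a)) -(real_normK (num_real b)).
have : 0 <= `|be| * (`|a| - `|b|) ^+ 2 by rewrite mulr_ge0 ?sqr_ge0.
lra.
Qed.

Section drift.
Context {R : realType} {d : nat} {Se So : set 'rV[R]_d}
  {Ve Vo : {fset 'rV[R]_d}}.
Variable m : nat.
Hypothesis hgeo : step_geometry Se So Ve Vo m.
Hypothesis hm : (2 <= m)%N.

Definition centered_count (v : 'rV[R]_d) (x : seq 'rV[R]_d) : R :=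
  (count_mem v x)%:R - (size x)%:R / (2 * m)%:R.

(** A step and its opposite must be treated together: they belong to different
parities, and each one drives the other through [beta]. *)
Definition potential (v : 'rV[R]_d) (x : seq 'rV[R]_d) : R :=
  centered_count v x ^+ 2 + centered_count (- v) x ^+ 2.

Lemma potential_ge0 v x : 0 <= potential v x.
Proof. by rewrite addr_ge0 ?sqr_ge0. Qed.

Lemma centered_count_le v x : `|centered_count v x| <= (size x)%:R.
Proof.
have h1 : (count_mem v x)%:R <= (size x)%:R :> R by rewrite ler_nat count_size.
have h2 : 0 <= (size x)%:R / (2 * m)%:R :> R by rewrite divr_ge0.
have h3 : (size x)%:R / (2 * m)%:R <= (size x)%:R :> R.
  rewrite ler_pdivrMr ?ltr0n; last by lia.
  by rewrite -natrM ler_nat; nia.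
have h4 : 0 <= (count_mem v x)%:R :> R by [].
by rewrite ler_norml /centered_count; apply/andP; split; lra.
Qed.

Variables (p q : R).
Hypotheses (hp : 0 <= p <= 1) (hq : 0 <= q <= 1).

Local Notation nxt := (next_prob Vo m p q).

Lemma rate_bounds (r : R) : 0 <= r <= 1 ->
  [/\ `|(m%:R * r - 1) / (m%:R - 1)| <= 1,
      0 <= (1 - r) / (m%:R - 1) <= 1 &
      (m%:R * r - 1) / (m%:R - 1) + (1 - r) / (m%:R - 1) * m%:R = 1].
Proof.
move=> /andP[r0 r1]; have M2 : 2 <= m%:R :> R by rewrite ler_nat.
have m1 : 0 < m%:R - 1 :> R by lra.
split; last by field; rewrite gt_eqF.
  have mr0 : 0 <= m%:R * r by rewrite mulr_ge0.
  have mr1 : m%:R * r <= m%:R by rewrite ler_piMr.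
  by rewrite ler_norml ler_pdivlMr// ler_pdivrMr//; apply/andP; split; lra.
by rewrite divr_ge0 ?ler_pdivrMr//; lra.
Qed.

Lemma next_prob_affine n x k v (A B : R) : x \in paths Ve Vo n.+1 ->
  v \in steps_at Ve Vo k ->
  \sum_(w <- steps_at Ve Vo k) nxt x w * (A + B * (w == v)%:R) = A + B * nxt x v.
Proof.
move=> hx hv; under eq_bigr => w _ do rewrite mulrDr mulrCA.
rewrite big_split/= -mulr_suml (next_prob_sum1 p q hm hgeo k hx)// mul1r -mulr_sumr.
congr (_ + _ * _); rewrite (bigD1_seq v) ?fset_uniq//= eqxx mulr1.
by rewrite big1 ?addr0// => w /negbTE ->; rewrite mulr0.
Qed.

(** The step [w] at the odd time moves the count of [v] only and the step [w'] at
the even time that of [- v], so averaging over [w'] and then over [w] brings in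
[next_prob] at [- v] and at [v].  In the constant [10], [2] bounds the two
squared increments and [8] comes from [centered_rate_next]. *)
Lemma potential_drift k x v : x \in paths Ve Vo (2 * k.+1)%N -> v \in Vo ->
  \sum_(w <- Vo) nxt x w * \sum_(w' <- Ve) nxt (w :: x) w' * potential v (w' :: w :: x)
  <= (1 + (alpha m p + `|beta m q|) / k.+1%:R) * potential v x + 10.
Proof.
have half1 : (2 * k.+1)%N.+1./2 = k.+1.
  by rewrite mul2n -[LHS]/(uphalf k.+1.*2) uphalf_double.
have half2 : uphalf (2 * k.+1)%N.+1 = k.+2.
  by rewrite mul2n -[LHS]/((k.+1.*2)./2.+1) doubleK.
have half3 : (2 * k)%N.+2./2 = k.+1 by rewrite mul2n -doubleS doubleK.
have half5 : (2 * k)%N.+2 = (2 * k.+1)%N by rewrite mulnS.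
have half4 : uphalf (2 * k)%N.+2 = k.+1 by rewrite mul2n -doubleS uphalf_double.
move=> hx hv; have sx := size_path hx.
have hVo : Vo = steps_at Ve Vo (2 * k.+1)%N.+1 by rewrite /steps_at oddS oddM.
have hVe : Ve = steps_at Ve Vo (2 * k.+1)%N.+2 by rewrite /steps_at 2!oddS oddM.
have M2 : 2 <= m%:R :> R by rewrite ler_nat.
have [al1 c01 h1] := rate_bounds hp; have [be1 c'01 h2] := rate_bounds hq.
have hnv : - v \in Ve by rewrite (mem_opp_even hgeo).
have m0 : 0 < m%:R :> R by lra.
pose K : R := k.+1%:R; have K0 : 0 < K by rewrite ltr0n.
pose A := centered_count v x; pose B := centered_count (- v) x.
have sxE : (size x)%:R / (2 * m)%:R = K / m%:R :> R.
  by rewrite sx !natrM; field; rewrite gt_eqF.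
have AE : A = (count_mem v x)%:R - K / m%:R by rewrite -sxE.
have BE : B = (count_mem (- v) x)%:R - K / m%:R by rewrite -sxE.
have A2 : `|A| <= 2 * K by rewrite (le_trans (centered_count_le _ _))// sx natrM.
have B2 : `|B| <= 2 * K by rewrite (le_trans (centered_count_le _ _))// sx natrM.
have V0 : 0 < m%:R^-1 :> R by rewrite invr_gt0.
have V1 : m%:R^-1 <= 1 :> R by rewrite invf_le1//; lra.
have sq1 (i : bool) : (i%:R - m%:R^-1) ^+ 2 <= 1 :> R.
  by move: V0 V1; case: i => /= ? ?; nra.
have cc w w' u : centered_count u (w' :: w :: x) =
    centered_count u x + ((w' == u)%:R + (w == u)%:R - m%:R^-1).
  rewrite /centered_count /= natrM -[(size x).+2]addn2 !natrD.
  by field; rewrite gt_eqF.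
have vneq w : w \in Vo -> (w == - v) = false.
  move=> hw; apply/eqP => e; move: hnv; rewrite -e (mem_even hgeo) ?hw//.
  by rewrite inE hw.
have vneq' w : w \in Ve -> (w == v) = false.
  move=> hw; apply/eqP => e; move: hw; rewrite e (mem_even hgeo) ?hv//.
  by rewrite inE hv.
(* [T + 2 A [w = v]] bounds the average over [w'] once the odd step is [w]. *)
pose T := potential v x + 10 + B * (alpha m p * B + beta m q * A) / K
  - 2 * A * m%:R^-1.
apply: (@le_trans _ _ (\sum_(w <- Vo) nxt x w * (T + 2 * A * (w == v)%:R))).
  rewrite big_seq [leRHS]big_seq; apply: ler_sum => w hw.
  rewrite ler_wpM2l ?next_prob_ge0//.
  pose i : R := (w == v)%:R.
  apply: (@le_trans _ _ (\sum_(w' <- Ve) nxt (w :: x) w' *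
    (potential v x + 2 + 2 * A * (i - m%:R^-1) - 2 * B * m%:R^-1
       + 2 * B * (w' == - v)%:R))).
    rewrite big_seq [leRHS]big_seq; apply: ler_sum => w' hw'.
    rewrite ler_wpM2l ?next_prob_ge0//.
    rewrite /potential !cc (vneq w)// (vneq' w')// -/A -/B.
    have := sq1 (w == v); have := sq1 (w' == - v); rewrite -/i.
    by move: (w' == - v)%:R => j /=; lra.
  have hwx : w :: x \in paths Ve Vo (2 * k.+1)%N.+1 by rewrite mem_pathsS hx -hVo hw.
  rewrite {1}hVe (next_prob_affine _ _ hwx) -?hVe//.
  rewrite (next_probE p q hm hgeo hwx) -?hVe// opprK.
  rewrite half1 half2.
  rewrite [count_mem _ (w :: x)]/= [count_mem v (w :: x)]/= (vneq w)//.
  have := @centered_rate_next R (alpha m p) (beta m q) _ _ m%:R K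
    (count_mem v x)%:R (count_mem (- v) x)%:R i K0 _ h1 h2 al1 be1 c'01.
  rewrite -AE -BE -/(alpha m p) -/(beta m q).
  have -> : 1 <= m%:R :> R by lra.
  have -> : 0 <= i <= 1 by rewrite /i; case: (w == v); rewrite !lexx ?ler01.
  move=> /(_ isT isT A2 B2).
  rewrite /T add0n natrD -/i [(2 * k.+1)%N.+1%:R](_ : _ = 2 * K + 1).
    by rewrite -[k.+2%:R]natr1 -/K [i + (count_mem v x)%:R]addrC; set Z := (_^-1 * _);
      apply: ler_of_eq_sub; ring.
  by rewrite -natr1 natrM.
rewrite {1}hVo.
have hx' : x \in paths Ve Vo (2 * k)%N.+2 by rewrite half5.
rewrite (next_prob_affine _ _ hx') -?hVo//.
rewrite (next_probE p q hm hgeo hx'); last by rewrite half5 -hVo.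
rewrite half3 half4.
rewrite half5 natrM -/K.
have := @centered_rate R (alpha m p) (beta m q) _ _ m%:R K
  (count_mem v x)%:R (count_mem (- v) x)%:R K0 m0 h1 h2.
rewrite -AE -BE -/K => /(canRL (subrK _)) ->.
have := quadratic_form_le (alpha m p) (beta m q) A B.
rewrite -(ler_pM2r (_ : 0 < K^-1)) ?invr_gt0// => hQ.
rewrite /T /potential -/A -/B.
by apply: ler_of_eq_sub hQ; field; rewrite !gt_eqF.
Qed.

End drift.

(** With [x = k + 1], the quantity [w k = e k / x^2 + C / x] decreases at each step
by at least [(2 - mu) / 4] times [e k / x^3]; the term [C / x] telescopes
against the constant [C]. *)
Lemma summable_of_drift (R : realFieldType) (e : nat -> R) (mu C : R) :
  (forall k, 0 <= e k) -> mu < 2 -> 0 <= C ->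
  (forall k, e k.+1 <= (1 + mu / k.+1%:R) * e k + C) ->
  forall n, \sum_(k < n) e k / k.+1%:R ^+ 3 <= 4 * (e 0%N + C) / (2 - mu).
Proof.
move=> e0 mu2 C0 he n; have d0 : 0 < 2 - mu by rewrite subr_gt0.
pose w k : R := e k / k.+1%:R ^+ 2 + C / k.+1%:R.
rewrite ler_pdivlMr//.
suff h N : (\sum_(k < N) e k / k.+1%:R ^+ 3) * (2 - mu) <= 4 * (w 0%N - w N).
  rewrite (le_trans (h n))// ler_pM2l// /w !expr1n !divr1 gerBl.
  by rewrite addr_ge0// divr_ge0// exprn_ge0.
elim: N => [|k IH]; first by rewrite big_ord0 mul0r subrr mulr0.
rewrite big_ord_recr/= mulrDl.
suff : e k / k.+1%:R ^+ 3 * (2 - mu) <= 4 * (w k - w k.+1).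
  by move=> /(lerD IH); rewrite -mulrDr addrA subrK.
rewrite /w -[k.+2%:R]natr1; have x1 : 1 <= k.+1%:R :> R by rewrite ler1n.
move: (he k) (e0 k) x1; move: (k.+1%:R) (e k.+1) (e k) => x e' a ha a0 x1.
have x0 : 0 < x by rewrite (lt_le_trans _ x1).
have y0 : 0 < x + 1 by rewrite addr_gt0.
apply: (@le_trans _ _ (4 * (a / x ^+ 2 + C / x -
    (((1 + mu / x) * a + C) / (x + 1) ^+ 2 + C / (x + 1))))); last first.
  rewrite ler_pM2l// lerD2l lerN2 lerD2r ler_pM2r// invr_gt0 exprn_gt0//.
rewrite -subr_ge0.
have -> : 4 * (a / x ^+ 2 + C / x -
    (((1 + mu / x) * a + C) / (x + 1) ^+ 2 + C / (x + 1))) - a / x ^+ 3 * (2 - mu) =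
  (a * (2 - mu) * (3 * x + 1) * (x - 1) + 4 * a * x + 4 * C * x ^+ 2) /
  (x ^+ 3 * (x + 1) ^+ 2).
  by field; rewrite !gt_eqF.
have h1 : 0 <= a * (2 - mu) * (3 * x + 1) * (x - 1).
  by rewrite !mulr_ge0 ?subr_ge0 ?addr_ge0 ?mulr_ge0// ltW.
have h2 : 0 <= 4 * a * x by rewrite !mulr_ge0// ltW.
have h3 : 0 <= 4 * C * x ^+ 2 by rewrite mulr_ge0 ?sqr_ge0// mulr_ge0.
by rewrite divr_ge0 ?addr_ge0// ?addr_ge0// mulr_ge0 ?exprn_ge0 ?(ltW x0) ?(ltW y0).
Qed.

Section mean_potential.
Context {R : realType} {d : nat} {Se So : set 'rV[R]_d}
  {Ve Vo : {fset 'rV[R]_d}} {m : nat} (hgeo : step_geometry Se So Ve Vo m).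
Hypothesis hm : (2 <= m)%N.
Variables (p q : R).
Hypotheses (hp : 0 <= p <= 1) (hq : 0 <= q <= 1).

Local Notation mean := (path_mean Ve Vo m p q).

Lemma path_mean_affine n (a b : R) f :
  mean n (fun x => a * f x + b) = a * mean n f + b * mean n (fun=> 1).
Proof.
rewrite /path_mean !mulr_sumr -big_split/=; apply: eq_bigr => x _.
by ring.
Qed.

Lemma path_mean_cst1 n : mean n (fun=> 1) = 1.
Proof.
elim: n => [|n IH]; first by rewrite /path_mean big_seq1 mulr1.
rewrite path_meanS -[RHS]IH /path_mean; apply: eq_big_seq => x hx; congr (_ * _).
under eq_bigr do rewrite mulr1.
case: n hx {IH} => [|n] hx; last first.
  by rewrite (next_prob_sum1 p q hm hgeo _ hx).
move: hx; rewrite mem_paths0 => /eqP ->.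
rewrite big_const_seq count_predT iter_addr_0 (card_steps_at hgeo).
rewrite -(mulr_natr m%:R^-1) mulVf//.
by rewrite pnatr_eq0; lia.
Qed.

Lemma mean_potential_drift k v : v \in Vo ->
  mean (2 * k.+2)%N (potential m v) <=
  (1 + (alpha m p + `|beta m q|) / k.+1%:R) * mean (2 * k.+1)%N (potential m v) + 10.
Proof.
move=> hv; set a := 1 + _.
have <- : mean (2 * k.+1)%N (fun x => a * potential m v x + 10) =
    a * mean (2 * k.+1)%N (potential m v) + 10.
  by rewrite path_mean_affine path_mean_cst1 mulr1.
have -> : (2 * k.+2 = (2 * k.+1).+2)%N by rewrite [LHS]mulnS.
rewrite [leLHS]path_meanS [leLHS]path_meanS; apply: path_mean_le => // x hx.
have := potential_drift hgeo hm hp hq hx hv.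
by rewrite /steps_at [odd _.+1]oddS [odd _.+2]oddS [odd _.+1]oddS oddM.
Qed.

(** [alpha + |beta|] is twice the larger of [gamma] and [delta]. *)
Lemma coupling_lt2 : gamma m p q < 1 -> delta m p q < 1 ->
  alpha m p + `|beta m q| < 2.
Proof. by rewrite /gamma /delta; case: ler0P => _ ? ?; lra. Qed.

Lemma mean_potential_summable v : v \in Vo -> gamma m p q < 1 -> delta m p q < 1 ->
  exists D, forall n,
  \sum_(k < n) mean (2 * k.+1)%N (potential m v) / k.+1%:R ^+ 3 <= D.
Proof.
move=> hv hg hd; eexists.
apply: (summable_of_drift (e := fun k => mean (2 * k.+1)%N (potential m v)) _
  (coupling_lt2 hg hd) (ler0n _ 10)) => k; last exact: mean_potential_drift.
rewrite /path_mean sumr_ge0// => x _.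
by rewrite mulr_ge0 ?path_prob_ge0 ?potential_ge0.
Qed.

End mean_potential.

(** * Independence of the past from the later sigma-fields *)

Section tail_independence.
Context {disp} {Omega : measurableType disp} {R : realType}.
Variables (P : probability Omega R) (F : nat -> set (set Omega)).
Hypothesis F_measurable : forall n A, F n A -> measurable A.

(** The past of the walk is not an intersection of events of the independent
sigma-fields, only a disjoint union of such intersections.  This factorization
property is stable under both operations, which gives the independence of the
past from the next sigma-field without a monotone class argument. *)
Definition tail_independent (n : nat) (E : set Omega) : Prop :=
  measurable E /\
  forall (J : {fset nat}) (A : nat -> set Omega),
    (forall j, j \in J -> (n <= j)%N /\ F j (A j)) ->
    P (E `&` \bigcap_(j in [set` J]) A j) = (P E * \prod_(j <- J) P (A j))%E.

Lemma tail_independent_setT : mutually_independent P F -> tail_independent 0 setT.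
Proof.
move=> indep; split=> [|J A hA]; first exact: measurableT.
by rewrite setTI probability_setT mul1e indep// => j /hA[].
Qed.

Lemma tail_independent_prob n E B :
  tail_independent n E -> F n B -> P (E `&` B) = (P E * P B)%E.
Proof.
move=> [_ hE] hB; have := hE [fset n]%fset (fun=> B).
rewrite set_fset1 bigcap_set1 big_seq_fset1; apply=> j.
by rewrite inE => /eqP ->.
Qed.

Lemma tail_independentI n E B :
  tail_independent n E -> F n B -> tail_independent n.+1 (E `&` B).
Proof.
move=> hE hB; split; first by apply: measurableI; [exact: hE.1|exact: F_measurable hB].
move=> J A hA.
have nJ : n \notin J by apply/negP => /hA[]; rewrite ltnn.
pose A' j := if j == n then B else A j.
have A'J j : j \in J -> A' j = A j.
  by rewrite /A'; case: eqP => // -> /(negP nJ).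
have bE : \bigcap_(j in [set` J]) A' j = \bigcap_(j in [set` J]) A j.
  by apply: eq_bigcapr => j /= /A'J.
have := hE.2 (n |` J)%fset A'; rewrite set_fsetU1 bigcap_setU1 big_fsetU1//= bE.
rewrite [A' n]/A' eqxx.
rewrite (eq_big_seq (fun j => P (A j))); last by move=> j /A'J ->.
rewrite setIA muleA (tail_independent_prob hE hB); apply=> j.
rewrite !inE => /predU1P[->|hj]; first by rewrite /A' eqxx.
by have [nj Fj] := hA j hj; rewrite A'J// ltnW.
Qed.

Lemma tail_independent_bigU n N (E : 'I_N -> set Omega) :
  trivIset setT E -> (forall i, tail_independent n (E i)) ->
  tail_independent n (\big[setU/set0]_i E i).
Proof.
move=> tE hE; have mE i : measurable (E i) by have [] := hE i.
split=> [|J A hA]; first exact: bigsetU_measurable.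
have mA : measurable (\bigcap_(j in [set` J]) A j).
  by apply: fin_bigcap_measurable => // j /= /hA[_]; exact: F_measurable.
rewrite big_distrl/= measure_bigsetU_ord//; last 2 first.
- by move=> i; exact: measurableI.
- exact: trivIset_setIr.
rewrite measure_bigsetU_ord// ge0_sume_distrl//.
by apply: eq_bigr => i _; exact: (hE i).2.
Qed.

End tail_independence.

(** * The law of the trajectory *)

Section trajectory.
Context {disp} {Omega : measurableType disp} {R : realType} {d : nat}.

Fixpoint trajectory (X : nat -> Omega -> 'rV[R]_d) (n : nat) (omega : Omega)
    : seq 'rV[R]_d :=
  if n is n'.+1 then X n omega :: trajectory X n' omega else [::].

Lemma size_trajectory X n omega : size (trajectory X n omega) = n.
Proof. by elim: n => //= n ->. Qed.

Lemma nth_trajectory X n i omega : (i < n)%N ->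
  nth 0 (trajectory X n omega) i = X (n - i)%N omega.
Proof.
elim: n i => // n IH [|i] hi /=; first by rewrite subn0.
by rewrite IH// subSS.
Qed.

Lemma count_steps_trajectory X n v omega :
  count_steps X n v omega = count_mem v (trajectory X n omega).
Proof.
rewrite /count_steps; elim: n => // n IH.
by rewrite [RHS]/= -IH -{1}[n.+1]addn1 iotaD count_cat /= addn0 addnC add1n.
Qed.

Lemma position_trajectory X n omega :
  position X n omega = \sum_(u <- trajectory X n omega) u.
Proof.
elim: n => [|n IH] /=; first by rewrite big_nil.
by rewrite big_cons IH addrC.
Qed.

Lemma measurable_rV_set1 (w : 'rV[R]_d) : @measurable _ (borel_rV R d) [set w].
Proof.
rewrite -[X in measurable X]setCK; apply: measurableC.
apply: sub_sigma_algebra; rewrite /= openC.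
exact/accessible_closed_set1/hausdorff_accessible/norm_hausdorff.
Qed.

Lemma sigma_rV_measurable (f : Omega -> 'rV[R]_d) A :
  measurable_fun setT (f : Omega -> borel_rV R d) -> sigma_rV f A -> measurable A.
Proof. by move=> mf [B mB <-]; exact: mf. Qed.

Lemma sigma_rV_set1 (f : Omega -> 'rV[R]_d) w : sigma_rV f (f @^-1` [set w]).
Proof. by exists [set w]; rewrite ?setTI//; exact: measurable_rV_set1. Qed.

End trajectory.

Section law.
Context {disp} {Omega : measurableType disp} {R : realType} {d : nat}
  {P : probability Omega R} {Se So : set 'rV[R]_d} {Ve Vo : {fset 'rV[R]_d}}
  {m : nat} {p q : R} {X : nat -> Omega -> 'rV[R]_d} {U : nat -> Omega -> nat}
  {G : nat -> 'rV[R]_d -> Omega -> 'rV[R]_d}.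
Hypotheses (hgeo : step_geometry Se So Ve Vo m)
  (hwalk : elephant_walk P Ve Vo m p q X U G).

Lemma sigma_family_measurable k A : (2 <= k)%N ->
  sigma_family (Vo `|` Ve)%fset (G k) A -> measurable A.
Proof.
move=> hk; apply: smallest_sub; first exact: sigma_algebra_measurable.
move=> B [v /= hv]; apply: sigma_rV_measurable.
exact: ew_G_measurable hwalk _ _ hk hv.
Qed.

Lemma sigma_step_measurable n A : sigma_step Ve Vo X U G n A -> measurable A.
Proof.
case: n => [|n] /=; first exact/sigma_rV_measurable/(ew_X1_measurable hwalk).
apply: smallest_sub; first exact: sigma_algebra_measurable.
move=> B [[C mC <-]|]; last exact: sigma_family_measurable.
exact: (ew_U_measurable hwalk).
Qed.

Lemma trajectory_paths n omega : trajectory X n omega \in paths Ve Vo n.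
Proof.
elim: n => // n IH; rewrite [trajectory _ _ _]/= mem_pathsS IH andbT.
case: n IH => [_|n IH]; first exact: ew_X1_values hwalk _.
have := ew_U_values hwalk (n := n.+1) omega isT => /andP[U1 Un].
rewrite (ew_rec hwalk)//; apply: (ew_G_values hwalk) => //.
rewrite -(subKn Un) -nth_trajectory; last by lia.
by apply: (path_subset IH); rewrite mem_nth// size_trajectory; lia.
Qed.

Definition step_event n v j w : set Omega :=
  (U n @^-1` [set j]) `&` (G n.+1 v @^-1` [set w]).

Lemma step_event_sigma n v j w : v \in (Vo `|` Ve)%fset ->
  sigma_step Ve Vo X U G n.+1 (step_event n.+1 v j w).
Proof.
move=> hv; apply: (@measurableI _ (g_sigma_algebraType
  (sigma_nat (U n.+1) `|` sigma_family (Vo `|` Ve)%fset (G n.+2)))).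
  by apply: sub_sigma_algebra; left; exists [set j]; rewrite ?setTI.
apply: sub_sigma_algebra; right; apply: sub_sigma_algebra.
by exists v => //; exact: sigma_rV_set1.
Qed.

Lemma step_event_prob n v j w : v \in (Vo `|` Ve)%fset ->
  w \in steps_at Ve Vo n.+2 -> (1 <= j <= n.+1)%N ->
  P (step_event n.+1 v j w) = (n.+1%:R^-1 * step_kernel Vo m p q v w)%:E.
Proof.
move=> hv hw hj; rewrite /step_event (ew_indep_UG hwalk (n := n.+1))//; first last.
- by apply: sub_sigma_algebra; exists v => //; exact: sigma_rV_set1.
- by exists [set j]; rewrite ?setTI.
rewrite (ew_U_law hwalk)// EFinM; congr (_ * _)%E.
have := hw; rewrite (mem_steps_at hgeo) ?(steps_at_sub hw)// /step_kernel => /eqP ->.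
have := mem_steps_at hgeo n.+2 hv; case: eqP => _ hvW.
  by rewrite (ew_G_law_same hwalk).
by rewrite (ew_G_law_opp hwalk)// inE hv hvW.
Qed.

(** Splitting on the remembered time [U n.+1] turns the random choice into
finitely many events; the [i]-th entry of the path is the step made at time
[n.+1 - i]. *)
Lemma trajectoryS n x w : size x = n.+1 -> w \in steps_at Ve Vo n.+2 ->
  trajectory X n.+2 @^-1` [set w :: x] =
  \big[setU/set0]_(i < n.+1) ((trajectory X n.+1 @^-1` [set x]) `&`
     step_event n.+1 (nth 0 x i) (n.+1 - i)%N w).
Proof.
move=> sx hw; rewrite -(bigcup_mkord n.+1 (fun i => (trajectory X n.+1 @^-1` [set x]) `&`
  step_event n.+1 (nth 0 x i) (n.+1 - i)%N w)).
 apply/seteqP; split=> omega.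
  move=> /= [hX hx].
  have := ew_U_values hwalk (n := n.+1) omega isT => /andP[U1 Un].
  exists (n.+1 - U n.+1 omega)%N; first by rewrite /=; lia.
  split; first exact: hx.
  split => /=; first by lia.
  rewrite -hX (ew_rec hwalk)// -hx -[_ :: _]/(trajectory X n.+1 omega).
  by rewrite nth_trajectory ?subKn//; lia.
move=> [i /= hi [hx [hU hG]]].
have -> : X n.+2 omega = w; last by rewrite hx.
rewrite (ew_rec hwalk)// hU -hG -hx -[_ :: _]/(trajectory X n.+1 omega).
by rewrite nth_trajectory.
Qed.

(** The two parts are proved together, since multiplying by the transition
probability requires the event so far to be independent of the sigma-field that
carries the next step. *)
Lemma trajectory_law n x : x \in paths Ve Vo n ->
  tail_independent P (sigma_step Ve Vo X U G) n (trajectory X n @^-1` [set x]) /\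
  P (trajectory X n @^-1` [set x]) = (path_prob Vo m p q x)%:E.
Proof.
have setT_ind := tail_independent_setT (ew_indep hwalk).
elim: n x => [|n IH] x.
  rewrite mem_paths0 => /eqP ->; rewrite (_ : _ @^-1` _ = setT); last first.
    by apply/seteqP; split.
  by rewrite probability_setT.
case: x => [/size_path//|w x]; rewrite mem_pathsS => /andP[hw hx].
have [hTx hPx] := IH _ hx; have sx := size_path hx.
case: n IH hw hx hTx hPx sx => [|n] IH hw hx hTx hPx sx.
  move: hx; rewrite mem_paths0 => /eqP ->.
  have -> : trajectory X 1 @^-1` [set [:: w]] = setT `&` (X 1%N @^-1` [set w]).
    by apply/seteqP; split=> omega /= => [[->]|[_ ->]].
  have hX1 : sigma_step Ve Vo X U G 0 (X 1%N @^-1` [set w]) := sigma_rV_set1 _ _.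
  split; first exact: tail_independentI sigma_step_measurable _ _ _ setT_ind hX1.
  by rewrite setTI (ew_X1_law hwalk)// /path_prob mul1r.
have hnth i : (i < n.+1)%N -> nth 0 x i \in (Vo `|` Ve)%fset.
  by rewrite -sx => hi; apply: path_subset hx _ _; exact: mem_nth.
pose E (i : 'I_n.+1) := (trajectory X n.+1 @^-1` [set x]) `&`
  step_event n.+1 (nth 0 x i) (n.+1 - i)%N w.
have -> : trajectory X n.+2 @^-1` [set w :: x] = \big[setU/set0]_i E i.
  exact: trajectoryS sx hw.
have hE (i : 'I_n.+1) : tail_independent P (sigma_step Ve Vo X U G) n.+2 (E i).
  apply: (tail_independentI sigma_step_measurable hTx).
  exact: step_event_sigma _ _ (hnth _ (ltn_ord i)).
have tE : trivIset [set: 'I_n.+1] (fun i => E i).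
  move=> i j _ _ [omega [[_ [Ui _]] [_ [Uj _]]]]; apply/val_inj => /=.
  move: (ltn_ord i) (ltn_ord j) Ui Uj => /=; lia.
split; first exact: (tail_independent_bigU sigma_step_measurable tE hE).
rewrite measure_bigsetU_ord//; last first.
  by move=> i; exact: (hE i).1.
rewrite (eq_bigr (fun i : 'I_n.+1 => (path_prob Vo m p q x * (n.+1%:R^-1 *
   step_kernel Vo m p q (nth 0 x i) w))%:E)); last first.
  move=> i _; have hi := ltn_ord i.
  apply: etrans (tail_independent_prob hTx (step_event_sigma _ _ (hnth _ hi))) _.
  by rewrite hPx step_event_prob ?hnth//; lia.
rewrite sumEFin -!mulr_sumr; congr (_%:E); rewrite [RHS]/=; congr (_ * _).
transitivity ((size x)%:R^-1 * \sum_(u <- x) step_kernel Vo m p q u w).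
  by rewrite [X in _ = _ * X](big_nth 0) big_mkord sx.
by case: x sx {hx hTx hPx hnth E hE tE}.
Qed.

End law.

Section expectation.
Context {disp} {Omega : measurableType disp} {R : realType} {d : nat}
  {P : probability Omega R} {Se So : set 'rV[R]_d} {Ve Vo : {fset 'rV[R]_d}}
  {m : nat} {p q : R} {X : nat -> Omega -> 'rV[R]_d} {U : nat -> Omega -> nat}
  {G : nat -> 'rV[R]_d -> Omega -> 'rV[R]_d}.
Hypotheses (hgeo : step_geometry Se So Ve Vo m)
  (hwalk : elephant_walk P Ve Vo m p q X U G).

Let cylinder_measurable n x : x \in paths Ve Vo n ->
  measurable (trajectory X n @^-1` [set x]).
Proof. by move=> hx; have [[]] := trajectory_law hgeo hwalk hx. Qed.

(** Functions of the first [n] steps are simple functions, so that their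
integrals are finite sums over paths. *)
Lemma path_function_indicator n (f : seq 'rV[R]_d -> R) omega :
  f (trajectory X n omega) =
  \sum_(x <- paths Ve Vo n) f x * \1_(trajectory X n @^-1` [set x]) omega.
Proof.
rewrite (bigD1_seq (trajectory X n omega)) ?uniq_paths ?(trajectory_paths hwalk)//=.
rewrite indicE mem_set// mulr1 big1_seq ?addr0// => x /andP[nx _].
by rewrite indicE memNset ?mulr0// => /= e; rewrite e eqxx in nx.
Qed.

Lemma measurable_path_function n (f : seq 'rV[R]_d -> R) :
  measurable_fun setT (fun omega => f (trajectory X n omega)).
Proof.
under eq_fun do rewrite path_function_indicator big_seq_cond big_mkcond.
apply: measurable_sum => x; rewrite andbT; case: (boolP (x \in _)) => hx //.
by apply: measurable_funM => //; exact/measurable_indicP/cylinder_measurable.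
Qed.

Lemma integral_path_function n (f : seq 'rV[R]_d -> R) : (forall x, 0 <= f x) ->
  (\int[P]_omega (f (trajectory X n omega))%:E = (path_mean Ve Vo m p q n f)%:E)%E.
Proof.
move=> f0.
under eq_integral do rewrite path_function_indicator -sumEFin big_seq_cond big_mkcond.
rewrite ge0_integral_sum//; last 2 first.
- move=> x; rewrite andbT; case: (boolP (x \in _)) => hx //.
  apply/measurable_EFinP; apply: measurable_funM => //.
  exact/measurable_indicP/cylinder_measurable.
- by move=> x omega _; case: ifP => // _; rewrite lee_fin mulr_ge0.
rewrite /path_mean [in RHS]big_seq_cond [in RHS]big_mkcond -sumEFin.
apply: eq_bigr => x _; rewrite andbT; case: (boolP (x \in _)) => hx.
  under eq_integral do rewrite EFinM.
  rewrite ge0_integralZl_EFin//; last first.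
    exact/measurable_EFinP/measurable_indicP/cylinder_measurable.
  rewrite integral_indic ?setIT//; last exact: cylinder_measurable.
  apply: etrans (congr1 (fun y => (f x)%:E * y)%E (trajectory_law hgeo hwalk hx).2) _.
  by rewrite -EFinM mulrC.
by rewrite integral0.
Qed.

End expectation.

(** * Almost sure convergence *)

Section convergence.
Context {disp} {Omega : measurableType disp} {R : realType} {d : nat}
  {P : probability Omega R} {Se So : set 'rV[R]_d} {Ve Vo : {fset 'rV[R]_d}}
  {m : nat} {p q : R} {X : nat -> Omega -> 'rV[R]_d} {U : nat -> Omega -> nat}
  {G : nat -> 'rV[R]_d -> Omega -> 'rV[R]_d}.
Hypotheses (hgeo : step_geometry Se So Ve Vo m) (hm : (2 <= m)%N)
  (hp : 0 <= p <= 1) (hq : 0 <= q <= 1)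
  (hwalk : elephant_walk P Ve Vo m p q X U G)
  (hgamma : gamma m p q < 1) (hdelta : delta m p q < 1).

Lemma ae_potential_summable v : v \in Vo ->
  {ae P, forall omega, (\sum_(0 <= k <oo)
    (potential m v (trajectory X (2 * k.+1)%N omega) / k.+1%:R ^+ 3)%:E < +oo)%E}.
Proof.
move=> hv.
have [D hD] := mean_potential_summable hgeo hm hp hq hv hgamma hdelta.
pose f k omega : \bar R :=
  (potential m v (trajectory X (2 * k.+1)%N omega) / k.+1%:R ^+ 3)%:E.
have f0 k omega : (0 <= f k omega)%E.
  by rewrite lee_fin divr_ge0 ?potential_ge0 ?exprn_ge0.
have mf k : measurable_fun setT (f k).
  apply/measurable_EFinP.
  exact: (measurable_path_function hgeo hwalk (2 * k.+1)%N (fun x => potential m v x / _)).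
have intf k : (\int[P]_omega f k omega =
    (path_mean Ve Vo m p q (2 * k.+1)%N (potential m v) / k.+1%:R ^+ 3)%:E)%E.
  rewrite /f (integral_path_function hgeo hwalk (2 * k.+1)%N
    (f := fun x => potential m v x / k.+1%:R ^+ 3)).
    rewrite /path_mean mulr_suml; congr (_%:E); apply: eq_bigr => x _.
    by rewrite mulrA.
  by move=> x; rewrite divr_ge0 ?potential_ge0 ?exprn_ge0.
have int_lty : (\int[P]_omega (\sum_(0 <= k <oo) f k omega) < +oo)%E.
  rewrite integral_nneseries// (eq_eseriesr (fun k _ => intf k)).
  apply: (@le_lt_trans _ _ D%:E); last by rewrite ltry.
  apply: lime_le; first by apply: is_cvg_nneseries => k _ _; rewrite -intf integral_ge0.
  by apply: nearW => n; rewrite sumEFin lee_fin big_mkord.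
have int : P.-integrable setT (fun omega => \sum_(0 <= k <oo) f k omega)%E.
  apply/integrableP; split; first exact: ge0_emeasurable_sum.
  under eq_integral do rewrite gee0_abs ?nneseries_ge0//.
  exact: int_lty.
apply: filterS (integrable_ae measurableT int) => omega /(_ I).
by rewrite ge0_fin_numE ?nneseries_ge0.
Qed.

End convergence.

Section conclusion.
Context {disp} {Omega : measurableType disp} {R : realType} {d : nat}
  {P : probability Omega R} {Se So : set 'rV[R]_d} {Ve Vo : {fset 'rV[R]_d}}
  {m : nat} {p q : R} {X : nat -> Omega -> 'rV[R]_d} {U : nat -> Omega -> nat}
  {G : nat -> 'rV[R]_d -> Omega -> 'rV[R]_d}.
Hypotheses (hgeo : step_geometry Se So Ve Vo m) (hm : (2 <= m)%N)
  (hp : 0 <= p <= 1) (hq : 0 <= q <= 1)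
  (hwalk : elephant_walk P Ve Vo m p q X U G)
  (hgamma : gamma m p q < 1) (hdelta : delta m p q < 1).

Lemma centered_count_unit_step (v : 'rV[R]_d) n (omega : Omega) :
  `|centered_count m v (trajectory X n.+1 omega) -
    centered_count m v (trajectory X n omega)| <= 1.
Proof.
rewrite /centered_count /= size_trajectory natrD -natr1 mulrDl.
set a := _%:R / _; have -> : forall b c y : R, b + c - (a + y) - (c - a) = b - y.
  by move=> b c y; ring.
have M0 : 0 < (2 * m)%:R :> R by rewrite ltr0n; lia.
have y0 : 0 <= 1 / (2 * m)%:R :> R by rewrite divr_ge0.
have y1 : 1 / (2 * m)%:R <= 1 :> R by rewrite ler_pdivrMr// mul1r ler1n; lia.
by rewrite ler_norml; case: (X n.+1 omega == v) => /=; apply/andP; split; lra.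
Qed.

Lemma frequency_cvg (v : 'rV[R]_d) (omega : Omega) :
  (\sum_(0 <= k <oo) (centered_count m v (trajectory X (2 * k.+1)%N omega) ^+ 2
    / k.+1%:R ^+ 3)%:E < +oo)%E ->
  ((count_steps X n v omega)%:R / n%:R : R) @[n --> \oo] --> ((2 * m)%:R^-1 : R).
Proof.
move=> hs.
have := ratio_cvg0_of_even_summable (centered_count_unit_step v ^~ omega) hs.
move=> /(cvgD (cvg_cst ((2 * m)%:R^-1 : R))); rewrite addr0; apply: cvg_trans.
apply: near_eq_cvg; near=> n => /=.
have n0 : n%:R != 0 :> R by rewrite pnatr_eq0 -lt0n; near: n; exact: nbhs_infty_gt.
transitivity ((2 * m)%:R^-1 + centered_count m v (trajectory X n omega) / n%:R) => //.
rewrite /centered_count size_trajectory count_steps_trajectory.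
by rewrite mulrBl [X in _ - X]mulrAC divff// mul1r addrC subrK.
Unshelve. all: by end_near.
Qed.

(** The potential of an odd step controls the step and its opposite, hence all
the steps. *)
Lemma potential_frequencies_cvg (v : 'rV[R]_d) (omega : Omega) :
  (\sum_(0 <= k <oo) (potential m v (trajectory X (2 * k.+1)%N omega)
    / k.+1%:R ^+ 3)%:E < +oo)%E ->
  forall u, u \in [:: v; - v] ->
  ((count_steps X n u omega)%:R / n%:R : R) @[n --> \oo] --> ((2 * m)%:R^-1 : R).
Proof.
move=> hs u hu; apply: frequency_cvg; apply: le_lt_trans hs.
apply: lee_nneseries => k _.
  by rewrite lee_fin divr_ge0 ?sqr_ge0 ?exprn_ge0.
rewrite lee_fin ler_pM2r ?invr_gt0 ?exprn_gt0// /potential.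
by move: hu; rewrite !inE => /orP[] /eqP ->; rewrite ?lerDl ?lerDr sqr_ge0.
Qed.

Lemma ae_frequency_cvg v : v \in (Vo `|` Ve)%fset ->
  {ae P, forall omega,
    ((count_steps X n v omega)%:R / n%:R : R) @[n --> \oo] --> ((2 * m)%:R^-1 : R)}.
Proof.
move=> hv; wlog : v hv / v \in Vo => [hwlog|hvo].
  have [|vNo] := boolP (v \in Vo); first exact: hwlog.
  have nvo : - v \in Vo by rewrite (mem_opp_odd hgeo) (mem_even hgeo).
  have := ae_potential_summable hgeo hm hp hq hwalk hgamma hdelta nvo.
  by apply: filterS => omega /potential_frequencies_cvg; apply; rewrite opprK !inE eqxx orbT.
have := ae_potential_summable hgeo hm hp hq hwalk hgamma hdelta hvo.
by apply: filterS => omega /potential_frequencies_cvg; apply; rewrite inE eqxx.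
Qed.

Lemma sum_steps0 : \sum_(v <- (Vo `|` Ve)%fset) v = 0.
Proof.
have opp_perm : perm_eq (Vo `|` Ve)%fset [seq - v | v <- (Vo `|` Ve)%fset].
  apply: uniq_perm; rewrite ?(map_inj_uniq oppr_inj) ?fset_uniq// => v.
  have oppV u : u \in (Vo `|` Ve)%fset -> - u \in (Vo `|` Ve)%fset.
    by rewrite !inE (mem_opp_odd hgeo) (mem_opp_even hgeo) orbC.
  apply/idP/mapP => [hv|[u hu ->]]; last exact: oppV.
  by exists (- v); rewrite ?opprK//; exact: oppV.
set S := LHS; have SN : S = - S.
  by rewrite {1}/S (perm_big _ opp_perm) big_map sumrN.
have : 2%:R *: S = 0 by rewrite scaler_nat mulr2n {2}SN subrr.
by move/eqP; rewrite scaler_eq0 pnatr_eq0 /= => /eqP.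
Qed.

Lemma position_frequencies n omega :
  n%:R^-1 *: position X n omega =
  \sum_(v <- (Vo `|` Ve)%fset) ((count_steps X n v omega)%:R / n%:R) *: v.
Proof.
rewrite position_trajectory.
have tV : {subset trajectory X n omega <= (Vo `|` Ve)%fset}.
  exact/path_subset/(trajectory_paths hwalk).
(* Group the steps of the trajectory by value. *)
have -> : \sum_(u <- trajectory X n omega) u =
    \sum_(v <- (Vo `|` Ve)%fset) (count_mem v (trajectory X n omega))%:R *: v.
  transitivity (\sum_(u <- trajectory X n omega)
      \sum_(v <- (Vo `|` Ve)%fset) (u == v)%:R *: v).
    apply: eq_big_seq => u /tV uV; rewrite (bigD1_seq u) ?fset_uniq//= eqxx scale1r.
    by rewrite big1 ?addr0// => v vu; rewrite eq_sym (negbTE vu) scale0r.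
  rewrite exchange_big/=; apply: eq_bigr => v _.
  by rewrite -scaler_suml (sum_indicator_count _ (pred1 v)).
rewrite scaler_sumr; apply: eq_bigr => v _.
by rewrite scalerA mulrC count_steps_trajectory.
Qed.

Lemma position_cvg0 omega :
  (forall v, v \in (Vo `|` Ve)%fset ->
    ((count_steps X n v omega)%:R / n%:R : R) @[n --> \oo] --> ((2 * m)%:R^-1 : R)) ->
  (n%:R^-1 *: position X n omega) @[n --> \oo] --> (0 : 'rV[R]_d).
Proof.
move=> hcvg; under eq_fun do rewrite position_frequencies big_seq.
have : \sum_(v <- (Vo `|` Ve)%fset | v \in (Vo `|` Ve)%fset)
    ((count_steps X n v omega)%:R / n%:R) *: v @[n --> \oo] -->
    \sum_(v <- (Vo `|` Ve)%fset | v \in (Vo `|` Ve)%fset) (2 * m)%:R^-1 *: v.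
  by apply: cvg_big => [|v hv]; [exact: add_continuous|]; exact: (cvgZr_tmp (hcvg v hv)).
by rewrite -[X in _ --> X]big_seq -scaler_sumr sum_steps0 scaler0.
Qed.

End conclusion.

Theorem theorem2p11 (R : realType) (d : nat) (hd : (1 <= d)%N)
    (Se So : set 'rV[R]_d) (Ve Vo : {fset 'rV[R]_d}) (m : nat)
    (hgeo : step_geometry Se So Ve Vo m) (hm : (2 <= m)%N)
    (p q : R) (hp : 0 <= p <= 1) (hq : 0 <= q <= 1)
    (disp : measure_display) (Omega : measurableType disp)
    (P : probability Omega R)
    (X : nat -> Omega -> 'rV[R]_d) (U : nat -> Omega -> nat)
    (G : nat -> 'rV[R]_d -> Omega -> 'rV[R]_d)
    (hwalk : elephant_walk P Ve Vo m p q X U G)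
    (hgamma : gamma m p q < 1) (hdelta : delta m p q < 1) :
  (forall v, v \in (Vo `|` Ve)%fset ->
    {ae P, forall omega : Omega,
      ((count_steps X n v omega)%:R / n%:R : R) @[n --> \oo]
        --> ((2 * m)%:R^-1 : R)}) /\
  {ae P, forall omega : Omega,
    (n%:R^-1 *: position X n omega) @[n --> \oo] --> (0 : 'rV[R]_d)}.
Proof.
have freq v (hv : v \in (Vo `|` Ve)%fset) :=
  ae_frequency_cvg hgeo hm hp hq hwalk hgamma hdelta hv.
split=> //.
have all_freq := filter_bigI (D := (Vo `|` Ve)%fset) (ae_filter_ringOfSetsType P) freq.
apply: filterS all_freq => omega hcvg.
by apply: (position_cvg0 hgeo hwalk) => v hv; exact: hcvg.
Qed.
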